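(* Let $\mathcal{S}$ be a linear subdivision scheme with symbol $$a(z)=z^{-s}(1+z)\prod_{j=1}^m\frac{1+\alpha_j z}{1+\alpha_j},$$ where $s\in\mathbb{Z}$, $m\ge 1$ and $\alpha_j>0$ for $j=1,\dots,m$, the factors being numbered so that $\alpha_1$ minimizes $\max\{\frac{1}{1+\alpha_j},\frac{\alpha_j}{1+\alpha_j}\}$ among $\alpha_1,\dots,\alpha_m$. Then the adaptation $\widetilde{\mathcal{S}}$ of $\mathcal{S}$ to manifold data based on the global refinement step (described in the context) converges for all admissible input data on the manifold.
   Context: Linear scheme and symbol: a linear subdivision scheme has a refinement rule $\mathcal{S}(\mathbf{f})_j=\sum_{i\in\mathbb{Z}}a_{j-2i}f_i$ with finitely supported real mask $(a_i)_{i\in\mathbb{Z}}$; its symbol is $a(z)=\sum_{i}a_iz^i$. Geodesic averages: $\mathcal{M}$ is a complete connected Riemannian manifold with Riemannian distance $d$. For $p_1,p_2\in\mathcal{M}$, $t\mapsto M_t(p_1,p_2)$, $t\in[0,1]$, is the (canonically chosen, if not unique) shortest geodesic, parametrized with constant speed, with $M_0(p_1,p_2)=p_1$, $M_1(p_1,p_2)=p_2$; thus $d(M_t(p_1,p_2),p_2)=(1-t)d(p_1,p_2)$ and $d(p_1,M_t(p_1,p_2))=t\,d(p_1,p_2)$. A data sequence $\mathbf{p}=(p_i)_{i\in\mathbb{Z}}$ in $\mathcal{M}$ is admissible if the geodesic curve between any two adjacent points is well-defined; all geodesic averages occurring in the repeated refinement are assumed well-defined. Put $\delta(\mathbf{p})=\sup_{i\in\mathbb{Z}}d(p_i,p_{i+1})$;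 data are understood to satisfy $\delta(\mathbf{p})<\infty$. Global refinement step $\mathbf{p}\mapsto\widetilde{\mathcal{S}}(\mathbf{p})$: set $q_{2i,0}=q_{2i+1,0}=p_i$ for $i\in\mathbb{Z}$; for $j=1,\dots,m$ successively set $q_{i,j}=M_{\frac{\alpha_j}{1+\alpha_j}}(q_{i,j-1},q_{i+1,j-1})$ for all $i\in\mathbb{Z}$; finally set $\widetilde{\mathcal{S}}(\mathbf{p})_{i-s+1}=q_{i,m}$ for all $i\in\mathbb{Z}$. The subdivision scheme is the repeated application of this step. Convergence: for $k\ge 0$ let $I(\widetilde{\mathcal{S}}^k(\mathbf{p})):\mathbb{R}\to\mathcal{M}$ be the piecewise geodesic interpolant that takes the value $\widetilde{\mathcal{S}}^k(\mathbf{p})_i$ at $i2^{-k}$ and, on $[i2^{-k},(i+1)2^{-k}]$, follows (with constant speed) the geodesic curve connecting $\widetilde{\mathcal{S}}^k(\mathbf{p})_i$ and $\widetilde{\mathcal{S}}^k(\mathbf{p})_{i+1}$. The scheme converges from $\mathbf{p}$ if the sequence $I(\widetilde{\mathcal{S}}^k(\mathbf{p}))$, $k\in\mathbb{Z}_+$, converges uniformly with respect to $d$. *)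

(* Defs.v *)
From HB Require Import structures.
From mathcomp Require Import all_boot all_order all_algebra.
From mathcomp Require Import all_classical all_reals all_analysis.
Set Implicit Arguments.
Unset Strict Implicit.
Unset Printing Implicit Defensive.
Import Order.TTheory GRing.Theory Num.Theory.
Import numFieldNormedType.Exports.
Local Open Scope classical_set_scope.
Local Open Scope ring_scope.

Section smooth_maps.
Context {R : realType} {V W : normedModType R}.

(* Only meaningful for [A] open.  In finite dimension, a map is C^(k+1) on [A]
   iff it is continuous there and all its directional derivatives exist and
   are C^k on [A]. *)
Fixpoint Ck_on (k : nat) (A : set V) (f : V -> W) : Prop :=
  (forall x, A x -> {for x, continuous f}) /\
  (if k is k'.+1 then
     forall v, (forall x, A x -> derivable f x v) /\ Ck_on k' A ('D_v f)
   else True).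

Definition smooth_on (A : set V) (f : V -> W) := forall k, Ck_on k A f.

End smooth_maps.

(* A smooth atlas of dimension [n] on the topological space [M].  The maps
   [coord c] and [uncoord c] are total, but are only meaningful on [dom c] and
   on [coord c @` dom c].  [chart_at] selects a chart around each point. *)
Record smooth_atlas (R : realType) (n : nat) (M : topologicalType) := SmoothAtlas {
  chart : Type;
  dom : chart -> set M;
  coord : chart -> M -> 'rV[R]_n;
  uncoord : chart -> 'rV[R]_n -> M;
  chart_at : M -> chart;
  chart_atP : forall x, dom (chart_at x) x;
  dom_open : forall c, open (dom c);
  codom_open : forall c, open (coord c @` dom c);
  coordK : forall c x, dom c x -> uncoord c (coord c x) = x;
  coord_continuous : forall c x, dom c x -> {for x, continuous (coord c)};
  uncoord_continuous : forall c u, (coord c @` dom c) u ->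
    {for u, continuous (uncoord c)};
  transition_smooth : forall c c',
    smooth_on (coord c @` (dom c `&` dom c')) (coord c' \o uncoord c)
}.
Arguments chart {R n M}.
Arguments dom {R n M s}.
Arguments coord {R n M s}.
Arguments uncoord {R n M s}.
Arguments chart_at {R n M}.

(* [gram c u] is the matrix of the metric in the chart [c] at the point with
   coordinates [u].  [gram_transition] says that transition maps are
   isometries, so that the local expressions define one tensor on [M]. *)
Record riemannian_metric (R : realType) (n : nat) (M : topologicalType)
    (A : smooth_atlas R n M) := RiemannianMetric {
  gram : chart A -> 'rV[R]_n -> 'M[R]_n;
  gram_smooth : forall c, smooth_on (coord c @` dom c) (gram c);
  gram_sym : forall c u, (coord c @` dom c) u -> (gram c u)^T = gram c u;
  gram_posdef : forall c u, (coord c @` dom c) u ->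
    forall v : 'rV[R]_n, v != 0 -> 0 < (v *m gram c u *m v^T) 0 0;
  gram_transition : forall c c' u, (coord c @` (dom c `&` dom c')) u ->
    forall v w : 'rV[R]_n,
      v *m gram c u *m w^T =
      'D_v (coord c' \o uncoord c) u *m gram c' (coord c' (uncoord c u))
        *m ('D_w (coord c' \o uncoord c) u)^T
}.

Section riemannian.
Context {R : realType} {n : nat} {M : topologicalType} {A : smooth_atlas R n M}.
Variable g : riemannian_metric A.

Definition Ck_curve (k : nat) (O : set R) (gamma : R -> M) : Prop :=
  (forall t, O t -> {for t, continuous gamma}) /\
  (forall c : chart A,
     Ck_on k ((O `&` gamma @^-1` dom c) : set R^o) (coord c \o gamma)).

(* The chart used does not matter, by [gram_transition]. *)
Definition speed (gamma : R -> M) (t : R) : R :=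
  let c := chart_at A (gamma t) in
  let v : 'rV[R]_n := derive1 (coord c \o gamma) t in
  Num.sqrt ((v *m gram g c (coord c (gamma t)) *m v^T) 0 0).

Definition curve_length (gamma : R -> M) (a b : R) : R :=
  \int[lebesgue_measure]_(t in `[a, b]) speed gamma t.

(* A C^1 curve on a compact interval is the restriction of a C^1 curve on an
   open neighbourhood of that interval. *)
Record C1_arc := C1Arc {
  arc_fun :> R -> M;
  arc_start : R;
  arc_end : R;
  arc_le : arc_start <= arc_end;
  arc_C1 : exists O : set R,
    [/\ open O, `[arc_start, arc_end] `<=` O & Ck_curve 1 O arc_fun]
}.

Fixpoint piecewise_C1_path (p : M) (s : seq C1_arc) (q : M) : Prop :=
  if s is c :: s' then
    c (arc_start c) = p /\ piecewise_C1_path (c (arc_end c)) s' q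
  else p = q.

Definition path_length (s : seq C1_arc) : R :=
  \sum_(c <- s) curve_length c (arc_start c) (arc_end c).

Definition riemannian_dist (p q : M) : R :=
  inf [set path_length s | s in [set s | piecewise_C1_path p s q]].

Definition partial_gram (c : chart A) (l i j : 'I_n) (u : 'rV[R]_n) : R :=
  'D_(delta_mx 0 l) (fun w => gram g c w i j) u.

Definition christoffel (c : chart A) (k i j : 'I_n) (u : 'rV[R]_n) : R :=
  2^-1 * \sum_(l < n) invmx (gram g c u) k l *
    (partial_gram c i j l u + partial_gram c j i l u - partial_gram c l i j u).

Definition geodesic_equation (gamma : R -> M) (t : R) : Prop :=
  forall c : chart A, dom c (gamma t) -> forall k : 'I_n,
    let x i r := coord c (gamma r) 0 i in
    derive1n 2 (x k) t +
      \sum_(i < n) \sum_(j < n)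
        christoffel c k i j (coord c (gamma t)) * derive1 (x i) t * derive1 (x j) t = 0.

Definition geodesic (gamma : R -> M) (a b : R) : Prop :=
  exists O : set R,
    [/\ open O, `[a, b] `<=` O, (forall k, Ck_curve k O gamma) &
        forall t, O t -> geodesic_equation gamma t].

(* [sigma] is a shortest geodesic from [p] to [q], parametrized over [0, 1]
   with constant speed; the values of [sigma] outside [0, 1] are irrelevant. *)
Definition shortest_geodesic (p q : M) (sigma : R -> M) : Prop :=
  exists gamma : R -> M,
    [/\ forall t, `[0, 1]%classic t -> sigma t = gamma t,
        geodesic gamma 0 1,
        gamma 0 = p /\ gamma 1 = q,
        curve_length gamma 0 1 = riemannian_dist p q &
        exists v : R, forall t, `[0, 1]%classic t -> speed gamma t = v].

(* A choice of shortest geodesics: [gavg t p q] is the point M_t(p, q), and it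
   is meaningful when the geodesic from [p] to [q] is well-defined, i.e. under
   [gavg_defined p q]. *)
Record geodesic_average := GeodesicAverage {
  gavg :> R -> M -> M -> M;
  gavg_defined : M -> M -> Prop;
  gavgP : forall p q, gavg_defined p q ->
    shortest_geodesic p q (fun t => gavg t p q)
}.

End riemannian.

Definition complete_space (M : uniformType) : Prop :=
  forall F : set_system M, ProperFilter F -> cauchy F -> exists x : M, F --> x.

Section linear_scheme.
Variable R : realType.

Record linear_scheme := LinearScheme {
  mask : int -> R;
  mask_finite : finite_set [set i | mask i != 0]
}.

Definition linear_refine (S : linear_scheme) (f : int -> R) (j : int) : R :=
  \sum_(i \in [set: int]) mask S (j - 2 * i) * f i.

(* The symbol as a function; a Laurent polynomial over [R] is determined by its
   values at the nonzero reals. *)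
Definition symbol (S : linear_scheme) (z : R) : R :=
  \sum_(i \in [set: int]) mask S i * z ^ i.

End linear_scheme.

Section manifold_scheme.
Context {R : realType} {n : nat} {M : metricType R} {A : smooth_atlas R n M}.
Context {g : riemannian_metric A}.
Variables (Mt : geodesic_average g) (s : int) (m : nat) (alpha : nat -> R).

Implicit Type p : int -> M.

(* [divz] by 2 is the floor, so the data point [p i] is placed at the indices
   [2 * i] and [2 * i + 1]. *)
Fixpoint averaging_round (p : int -> M) (j : nat) (i : int) : M :=
  if j is j'.+1 then
    Mt (alpha j / (1 + alpha j))
       (averaging_round p j' i) (averaging_round p j' (i + 1))
  else p (i %/ 2)%Z.

Definition refinement_step p (l : int) : M := averaging_round p m (l + s - 1).

Definition subdivide (k : nat) p : int -> M := iter k refinement_step p.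

(* First all geodesics between adjacent data points, then all geodesic averages
   that occur in the repeated refinement. *)
Definition admissible p : Prop :=
  (forall i, gavg_defined Mt (p i) (p (i + 1))) /\
  (forall (k j : nat) (i : int), (j < m)%N ->
     gavg_defined Mt (averaging_round (subdivide k p) j i)
                     (averaging_round (subdivide k p) j (i + 1))).

Definition delta p : \bar R :=
  ereal_sup [set (mdist (p i) (p (i + 1)))%:E | i in [set: int]].

Definition interpolant p (k : nat) (x : R) : M :=
  let i := Num.floor (x * 2 ^+ k) in
  Mt (x * 2 ^+ k - i%:~R) (subdivide k p i) (subdivide k p (i + 1)).

Definition converges_from p : Prop :=
  exists f : R -> M, {uniform, interpolant p @ \oo --> f}.

End manifold_scheme.

(* Main.v *)
(** A shortest geodesic has constant speed and bounds the distance of its points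
    by its length, so [d(p, M_t(p,q)) <= t d(p,q)] and
    [d(M_t(p,q), q) <= (1-t) d(p,q)].  Write [delta] for the largest distance
    between consecutive points.  On the doubled data the first round shrinks
    [delta] by the factor [mu = max(1/(1+alpha_1), alpha_1/(1+alpha_1)) < 1];
    the later rounds do not increase it, since [q_{i+1,j-1}] lies between
    [q_{i,j}] and [q_{i+1,j}] at total distance at most [delta].  A step moves the
    points by at most a constant times [delta], so consecutive interpolants are
    [O(mu^k)] apart and completeness gives a uniform limit. *)
Require Import Defs.
From mathcomp Require Import all_boot all_order all_algebra.
From mathcomp Require Import all_classical all_reals all_analysis.
From mathcomp Require Import zify ring lra.
Set Implicit Arguments.
Unset Strict Implicit.
Unset Printing Implicit Defensive.
Import Order.TTheory GRing.Theory Num.Theory.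
Import numFieldNormedType.Exports.
Local Open Scope classical_set_scope.
Local Open Scope ring_scope.

(** * Uniform limits of sequences with geometrically decaying steps *)

Lemma geometric_steps_dist (R : realType) (M : metricType R) (u : nat -> M)
    (C mu : R) :
    0 <= mu < 1 -> (forall k, mdist (u k) (u k.+1) <= C * mu ^+ k) ->
  forall k j, mdist (u k) (u (k + j)%N) <= C * mu ^+ k / (1 - mu).
Proof.
move=> /andP[mu0 mu1] uC k j.
have C0 : 0 <= C by have := le_trans (mdist_ge0 _ _) (uC 0%N); rewrite mulr1.
have mu'0 : 0 < 1 - mu by rewrite subr_gt0.
(* The exact partial geometric sum, with factor [1 - mu ^+ j], is what the induction on [j]
   preserves. *)
suff ukj : mdist (u k) (u (k + j)%N) <= C * mu ^+ k * (1 - mu ^+ j) / (1 - mu).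
  apply: le_trans ukj _; rewrite ler_pM2r ?invr_gt0//.
  by rewrite ler_piMr ?gerBl ?exprn_ge0// mulr_ge0 ?exprn_ge0.
elim: j => [|j IHj]; first by rewrite addn0 mdistxx expr0 subrr mulr0 mul0r.
rewrite addnS; apply: le_trans (metric_triangle _ (u (k + j)%N) _) _.
apply: le_trans (lerD IHj (uC _)) _.
rewrite exprD exprS le_eqVlt; apply/orP; left; apply/eqP.
by field; rewrite gt_eqF.
Qed.

(** Completeness gives the limit pointwise; the tail bound [r k] does not depend on [x], which makes
    the convergence uniform. *)
Lemma geometric_uniform_cvg (R : realType) (T : choiceType) (M : metricType R)
    (u : nat -> T -> M) (C mu : R) :
    complete_space M -> 0 <= mu < 1 ->
    (forall k x, mdist (u k x) (u k.+1 x) <= C * mu ^+ k) ->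
  exists f : T -> M, {uniform, u @ \oo --> f}.
Proof.
move=> Mcomplete mu01 uC; have /andP[mu0 mu1] := mu01.
pose r k := C * mu ^+ k / (1 - mu).
have ru x k j : mdist (u k x) (u (k + j)%N x) <= r k.
  exact: (@geometric_steps_dist _ _ (u^~ x)).
have r_cvg0 : r @ \oo --> 0.
  rewrite -(mul0r (1 - mu)^-1) -(mulr0 C).
  apply: cvgMl; apply: cvgMr; apply: cvg_expr; by rewrite ger0_norm.
have r_small e : 0 < e -> exists k, forall j, (k <= j)%N -> r j < e.
  move=> e0; have /cvgrPdist_lt /(_ _ e0)[k _ rk] := r_cvg0.
  exists k => j /rk; rewrite sub0r normrN; exact: le_lt_trans (ler_norm _).
have u_cvg x : exists l : M, u^~ x @ \oo --> l.
  apply: Mcomplete; apply: cauchy_exP => e /r_small[k rk].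
  exists (u k x); exists k => // j /= kj.
  by rewrite ballEmdist/= -(subnKC kj) (le_lt_trans (ru _ _ _)) ?rk.
pose f x := sval (cid (u_cvg x)).
have uf x : u^~ x @ \oo --> f x := svalP (cid (u_cvg x)).
have ruf x k : mdist (u k x) (f x) <= r k.
  (* The tail bound passes to the limit through a term [u (k + N) x] that is [e]-close to [f x]. *)
  apply/ler_addgt0Pl => e e0.
  have /metricType_numDomainType.cvgrPdist_lt /(_ _ e0)[N _ ufN] := uf x.
  apply: le_trans (metric_triangle _ (u (k + N)%N x) _) _.
  rewrite addrC lerD ?ru// metric_sym ltW//; apply: ufN => /=; lia.
exists f => P /uniform_nbhs[E [entE EP]].
have := entE; rewrite -entourage_ballE => -[e /= e0 eE].
have [N rN] := r_small _ e0; exists N => // k /= Nk.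
apply: EP => /= x _; apply: eE => /=.
by rewrite ballEmdist/= metric_sym (le_lt_trans (ruf _ _)) ?rN.
Qed.

(** * Distances along shortest geodesics *)

Section riemannian_paths.
Context {R : realType} {n : nat} {M : topologicalType} {A : smooth_atlas R n M}.
Context {g : riemannian_metric A}.

Lemma curve_length_ge0 (gamma : R -> M) (a b : R) :
  0 <= curve_length g gamma a b.
Proof. by apply: Rintegral_ge0 => t _; exact: sqrtr_ge0. Qed.

Lemma curve_length_constant_speed (gamma : R -> M) (v a b : R) :
    a <= b -> (forall t, `[a, b]%classic t -> speed g gamma t = v) ->
  curve_length g gamma a b = v * (b - a).
Proof.
move=> ab gv.
have <- : fine (lebesgue_measure (`[a, b] : set R)) = b - a.
  rewrite lebesgue_measure_itv/= lte_fin.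
  by case: ltgtP ab => // -> _; rewrite subrr.
rewrite -Rintegral_cst; last exact: measurable_itv.
by apply: eq_Rintegral => t /set_mem/gv.
Qed.

Lemma riemannian_dist_le_length (c : @C1_arc R n M A) :
  riemannian_dist g (c (arc_start c)) (c (arc_end c)) <=
  curve_length g c (arc_start c) (arc_end c).
Proof.
apply: ge_inf.
  exists 0 => _ [s _ <-]; apply: sumr_ge0 => d _; exact: curve_length_ge0.
by exists [:: c] => //; rewrite /path_length big_seq1.
Qed.

(** The restriction to [[a, b]] is a competing path of length [v * (b - a)], and the speed [v] is
    the distance from [p] to [q], as the whole curve over [[0, 1]] realizes it. *)
Lemma shortest_geodesic_dist_le (p q : M) (sigma : R -> M) (a b : R) :
    shortest_geodesic g p q sigma -> 0 <= a -> a <= b -> b <= 1 ->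
  riemannian_dist g (sigma a) (sigma b) <= (b - a) * riemannian_dist g p q.
Proof.
move=> [gamma [sigmaE [U [oU U01 gammaC _]] _ gamma_short [v gammav]]] a0 ab b1.
have sub01 t : `[a, b]%classic t -> `[0, 1]%classic t.
  rewrite /= !in_itv/= => /andP[at_ tb].
  by rewrite (le_trans a0)//= (le_trans tb).
have arcC : exists U : set R,
    [/\ open U, `[a, b] `<=` U & Ck_curve (A := A) 1 U gamma].
  by exists U; split => // t /sub01 /U01.
have := riemannian_dist_le_length (C1Arc ab arcC).
rewrite /= !sigmaE; try by apply: sub01; rewrite /= in_itv/= lexx ab.
rewrite -gamma_short !(@curve_length_constant_speed _ v)//; last first.
  by move=> t /sub01 /gammav.
by rewrite subr0 mulr1 mulrC.
Qed.

Lemma shortest_geodesic_ends (p q : M) (sigma : R -> M) :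
  shortest_geodesic g p q sigma -> sigma 0 = p /\ sigma 1 = q.
Proof.
move=> [gamma [sigmaE _ gamma01 _ _]].
by rewrite !sigmaE//= in_itv/= lexx ler01.
Qed.

End riemannian_paths.

(** * Edge contraction and point displacement in one refinement step *)

Section manifold_scheme.
Context {R : realType} {n : nat} {M : metricType R} {A : smooth_atlas R n M}.
Context {g : riemannian_metric A}.
Hypothesis M_dist : forall p q : M, mdist p q = riemannian_dist g p q.
Variables (Mt : geodesic_average g) (s : int) (m : nat) (alpha : nat -> R).
Hypothesis alpha_gt0 : forall j, (1 <= j <= m)%N -> 0 < alpha j.

Let t j := alpha j / (1 + alpha j).

Lemma weight_itv j : (1 <= j <= m)%N -> 0 < t j < 1.
Proof.
move=> /alpha_gt0 aj; rewrite divr_gt0 ?ltr_pdivrMr ?mul1r ?addr_gt0//=.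
by rewrite ltrDr.
Qed.

Lemma gavg_dist_start p q a : gavg_defined Mt p q -> 0 <= a <= 1 ->
  mdist p (Mt a p q) <= a * mdist p q.
Proof.
move=> /gavgP pq /andP[a0 a1].
have := shortest_geodesic_dist_le pq (lexx 0) a0 a1.
by rewrite /= (shortest_geodesic_ends pq).1 subr0 -!M_dist.
Qed.

Lemma gavg_dist_end p q a : gavg_defined Mt p q -> 0 <= a <= 1 ->
  mdist (Mt a p q) q <= (1 - a) * mdist p q.
Proof.
move=> /gavgP pq /andP[a0 a1].
have := shortest_geodesic_dist_le pq a0 a1 (lexx 1).
by rewrite /= (shortest_geodesic_ends pq).2 -!M_dist.
Qed.

(** A real bound replaces the extended real supremum [delta p]. *)
Definition edges_le (p : int -> M) (D : R) :=
  forall i, mdist (p i) (p (i + 1)) <= D.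

Lemma edges_le_ge0 p D : edges_le p D -> 0 <= D.
Proof. by move=> /(_ 0); exact: le_trans (mdist_ge0 _ _). Qed.

Lemma edges_le_dist p D : edges_le p D ->
  forall (i : int) (k : nat), mdist (p i) (p (i + k%:Z)) <= k%:R * D.
Proof.
move=> pD i; elim=> [|k IHk]; first by rewrite addr0 mdistxx mul0r.
apply: le_trans (metric_triangle _ (p (i + k%:Z)) _) _.
rewrite -natr1 mulrDl mul1r lerD//.
by rewrite (_ : i + k.+1%:Z = i + k%:Z + 1); [exact: pD|lia].
Qed.

Lemma edges_le_abs_dist p D : edges_le p D ->
  forall i j (N : nat), (`|i - j| <= N)%N -> mdist (p i) (p j) <= N%:R * D.
Proof.
move=> pD i j N ijN; have D0 := edges_le_ge0 pD.
apply: (@le_trans _ _ (`|i - j|%:R * D)); last by rewrite ler_wpM2r// ler_nat.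
wlog ij : i j ijN / i <= j.
  move=> H; case: (leP i j) => [|/ltW] ij; first exact: H.
  by rewrite metric_sym distnC H// distnC.
by rewrite [in X in mdist _ X](_ : j = i + `|i - j|%:Z); [exact: edges_le_dist|lia].
Qed.

(** The second half of admissibility, at a single refinement level. *)
Definition rounds_defined (p : int -> M) := forall (j : nat) (i : int),
  (j < m)%N -> gavg_defined Mt (averaging_round Mt alpha p j i)
                               (averaging_round Mt alpha p j (i + 1)).

(** Each edge of [p] occurs in the doubled data, at indices [2 * i + 1] and [2 * i + 2]. This makes
    the interpolants meaningful at every level. *)
Lemma rounds_defined_edge p : (1 <= m)%N -> rounds_defined p ->
  forall i, gavg_defined Mt (p i) (p (i + 1)).
Proof.
move=> m1 /(_ 0%N) p_def i; have /= := p_def (2 * i + 1) m1.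
have -> : ((2 * i + 1) %/ 2)%Z = i by lia.
by have -> : ((2 * i + 1 + 1) %/ 2)%Z = i + 1 by lia.
Qed.

Let mu := Num.max (1 / (1 + alpha 1%N)) (alpha 1%N / (1 + alpha 1%N)).

Lemma contraction_itv : (1 <= m)%N -> 0 <= mu < 1.
Proof.
move=> m1; have a1 : 0 < alpha 1%N by exact: alpha_gt0.
rewrite le_max gt_max !ltr_pdivrMr ?addr_gt0// !mul1r ltrDr ltrDl a1 ltr01.
by rewrite invr_ge0 addr_ge0// ltW.
Qed.

(* Since the data are doubled first, the initial round leaves every other point
   in place and splits each edge in the ratio of its two weights. *)
Lemma first_round_edges p D : (1 <= m)%N -> rounds_defined p -> edges_le p D ->
  edges_le (averaging_round Mt alpha p 1) (mu * D).
Proof.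
move=> m1 p_def pD i; have D0 := edges_le_ge0 pD.
have /andP[t0 t1] : 0 < t 1 < 1 by exact: weight_itv.
have t01 : 0 <= t 1 <= 1 by rewrite !ltW.
(* A geodesic average of a point with itself lies at distance zero from it. *)
have fixed l : gavg_defined Mt (p l) (p l) -> Mt (t 1) (p l) (p l) = p l.
  move=> /gavg_dist_start /(_ t01); rewrite mdistxx mulr0 => d0.
  by apply/esym/mdist_positivity/eqP; rewrite eq_le d0 mdist_ge0.
have d1 : t 1 * D <= mu * D by rewrite ler_wpM2r// le_max lexx orbT.
have d2 : (1 - t 1) * D <= mu * D.
  rewrite ler_wpM2r// le_max; apply/orP; left.
  rewrite le_eqVlt /t; apply/orP; left; apply/eqP.
  by field; rewrite gt_eqF// addr_gt0// alpha_gt0.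
have := p_def 0%N i m1; have := p_def 0%N (i + 1) m1; rewrite /=.
pose l := (i %/ 2)%Z; have [iE|iE] : i = 2 * l \/ i = 2 * l + 1 by lia.
- have -> : ((i + 1) %/ 2)%Z = l by lia.
  have -> : ((i + 1 + 1) %/ 2)%Z = l + 1 by lia.
  rewrite -/l => ? ?; rewrite -/(t 1) fixed//.
  apply: le_trans (gavg_dist_start _ _) _ => //.
  by apply: le_trans d1; rewrite ler_wpM2l// ltW.
- have -> : ((i + 1) %/ 2)%Z = l + 1 by lia.
  have -> : ((i + 1 + 1) %/ 2)%Z = l + 1 by lia.
  rewrite -/l => ? ?; rewrite -/(t 1) [X in mdist _ X]fixed//.
  apply: le_trans (gavg_dist_end _ _) _ => //.
  by apply: le_trans d2; rewrite ler_wpM2l// subr_ge0 ltW.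
Qed.

Lemma next_round_edges p D j : (j < m)%N -> rounds_defined p ->
  edges_le (averaging_round Mt alpha p j) D ->
  edges_le (averaging_round Mt alpha p j.+1) D.
Proof.
move=> jm p_def pD i /=.
have /andP[t0 t1] : 0 < t j.+1 < 1 by exact: weight_itv.
have t01 : 0 <= t j.+1 <= 1 by rewrite !ltW.
apply: le_trans (metric_triangle _ (averaging_round Mt alpha p j (i + 1)) _) _.
(* Via the shared old point [i + 1]: the first piece ends an edge, the second starts the next one,
   and their weights add up to one. *)
have -> : D = (1 - t j.+1) * D + t j.+1 * D by rewrite -mulrDl subrK mul1r.
apply: lerD.
  apply: le_trans (gavg_dist_end _ t01) _; first exact: p_def.
  by rewrite ler_wpM2l// subr_ge0 ltW.
apply: le_trans (gavg_dist_start _ t01) _; first exact: p_def.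
by rewrite ler_wpM2l// ltW.
Qed.

Lemma rounds_edges_contract p D : (1 <= m)%N -> rounds_defined p ->
  edges_le p D -> edges_le (averaging_round Mt alpha p m) (mu * D).
Proof.
move=> m1 p_def pD.
(* The induction starts at round one, where the factor [mu] is gained; [1 <= m] ensures that this
   round takes place. *)
suff H j : (j < m)%N -> edges_le (averaging_round Mt alpha p j.+1) (mu * D).
  by rewrite -(prednK m1); apply: H; rewrite prednK.
elim: j => [|j IHj] jm; first exact: first_round_edges.
by apply: next_round_edges => //; apply/IHj/ltnW.
Qed.

Lemma round_edges_le p D j : (j <= m)%N -> rounds_defined p -> edges_le p D ->
  edges_le (averaging_round Mt alpha p j) D.
Proof.
move=> jm p_def pD; elim: j jm => [|j IHj] jm; last first.
  by apply: next_round_edges => //; apply/IHj/ltnW.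
(* In the doubled data, neighbours come from data indices at most one apart. *)
move=> i /=; rewrite -[D]mul1r; apply: (@edges_le_abs_dist _ _ pD _ _ 1%N); lia.
Qed.

(** Each round moves a point along part of one edge, hence by at most [D]; [p (i %/ 2)] is its
    position before the first round. *)
Lemma round_displacement p D j i : (j <= m)%N -> rounds_defined p ->
    edges_le p D ->
  mdist (averaging_round Mt alpha p j i) (p (i %/ 2)%Z) <= j%:R * D.
Proof.
move=> jm p_def pD; elim: j jm => [|j IHj] jm; first by rewrite /= mdistxx mul0r.
apply: le_trans (metric_triangle _ (averaging_round Mt alpha p j i) _) _.
rewrite -(natr1 j) mulrDl mul1r addrC lerD ?IHj ?(ltnW jm)//= metric_sym.
have /andP[t0 t1] : 0 < t j.+1 < 1 by exact: weight_itv.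
apply: le_trans (gavg_dist_start _ _) _; [exact: p_def|by rewrite !ltW|].
have := round_edges_le (ltnW jm) p_def pD i.
by apply: le_trans; rewrite ler_piMl ?mdist_ge0// ltW.
Qed.

Lemma refinement_step_edges p D : (1 <= m)%N -> rounds_defined p ->
  edges_le p D -> edges_le (refinement_step Mt s m alpha p) (mu * D).
Proof.
move=> m1 p_def pD l; rewrite /refinement_step.
have -> : l + 1 + s - 1 = l + s - 1 + 1 by ring.
exact: rounds_edges_contract.
Qed.

Lemma refinement_step_displacement p D l : rounds_defined p -> edges_le p D ->
  mdist (refinement_step Mt s m alpha p l) (p (l %/ 2)%Z) <=
  (m + `|s - 1|.+1)%N%:R * D.
Proof.
move=> p_def pD; apply: le_trans (metric_triangle _ (p ((l + s - 1) %/ 2)%Z) _) _.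
(* The rounds contribute [m]; the index shift by [s - 1] changes the halved index by at most
   [|s - 1| + 1]. *)
rewrite natrD mulrDl lerD// ?round_displacement//.
by apply: (@edges_le_abs_dist _ _ pD); lia.
Qed.

Lemma subdivide_edges p D : (1 <= m)%N ->
    (forall k, rounds_defined (subdivide Mt s m alpha k p)) -> edges_le p D ->
  forall k, edges_le (subdivide Mt s m alpha k p) (D * mu ^+ k).
Proof.
move=> m1 p_def pD; elim=> [|k IHk]; first by rewrite expr0 mulr1.
rewrite exprS mulrCA; exact: refinement_step_edges m1 (p_def k) IHk.
Qed.

(** * Comparison of consecutive interpolants *)

Lemma interpolant_dist_le p D k x :
    (forall i, gavg_defined Mt (subdivide Mt s m alpha k p i)
                               (subdivide Mt s m alpha k p (i + 1))) ->
    edges_le (subdivide Mt s m alpha k p) D ->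
  mdist (subdivide Mt s m alpha k p (Num.floor (x * 2 ^+ k)))
        (interpolant Mt s m alpha p k x) <= D.
Proof.
move=> p_def pD; rewrite /interpolant; set i := Num.floor _.
have frac : 0 <= x * 2 ^+ k - i%:~R <= 1.
  by rewrite subr_ge0 floor_le lerBlDl -intrD1 ltW// floorD1_gt.
have /andP[f0 f1] := frac.
apply: le_trans (gavg_dist_start (p_def _) frac) _.
by apply: le_trans (pD i); rewrite ler_piMl ?mdist_ge0.
Qed.

(** The left node of [x] at level [k + 1] thus descends from its left node at level [k], the pair
    that the displacement bound compares. *)
Lemma floor_half (x : R) (k : nat) :
  (Num.floor (x * 2 ^+ k.+1) %/ 2)%Z = Num.floor (x * 2 ^+ k).
Proof.
apply/esym/floor_def.
have := floor_itv (x * 2 ^+ k.+1); set l := Num.floor _.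
rewrite exprS (_ : x * (2 * 2 ^+ k) = 2 * (x * 2 ^+ k)); last by ring.
have : 2 * (l %/ 2)%Z <= l by lia.
have : l + 1 <= 2 * ((l %/ 2)%Z + 1) by lia.
rewrite -!(ler_int R) !intrM; lra.
Qed.

(** The three terms of the constant bound the legs of a detour: from the level [k] interpolant to
    its left node [b], from [b] to the new left node [a], and from [a] to the level [k + 1]
    interpolant, whose edges are shorter by [mu]. *)
Lemma interpolant_step p D : (1 <= m)%N -> admissible Mt s m alpha p ->
    edges_le p D ->
  forall k x, mdist (interpolant Mt s m alpha p k x)
                    (interpolant Mt s m alpha p k.+1 x) <=
    (1 + (m + `|s - 1|.+1)%N%:R + mu) * D * mu ^+ k.
Proof.
move=> m1 [_ p_def] pD k x; have p_edges := subdivide_edges m1 p_def pD.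
have edge_def k' := rounds_defined_edge m1 (p_def k').
have aj := interpolant_dist_le x (edge_def k.+1) (p_edges k.+1).
have ib := interpolant_dist_le x (edge_def k) (p_edges k).
set a := subdivide _ _ _ _ k.+1 p _ in aj; set b := subdivide _ _ _ _ k p _ in ib.
have ab : mdist a b <= (m + `|s - 1|.+1)%N%:R * (D * mu ^+ k).
  rewrite /b -floor_half.
  exact: refinement_step_displacement (p_def k) (p_edges k).
rewrite -mulrA !mulrDl mul1r -addrA.
apply: le_trans (metric_triangle _ b _) _; apply: lerD; first by rewrite metric_sym.
apply: le_trans (metric_triangle _ a _) _; apply: lerD; first by rewrite metric_sym.
by rewrite mulrCA -exprS.
Qed.

End manifold_scheme.

Theorem corollary3p3 (R : realType) (n : nat)
    (M : metricType R) (A : smooth_atlas R n M) (g : riemannian_metric A)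
    (M_connected : connected [set: M])
    (M_dist : forall p q : M, mdist p q = riemannian_dist g p q)
    (M_complete : complete_space M)
    (Mt : geodesic_average g)
    (S : linear_scheme R) (s : int) (m : nat) (alpha : nat -> R)
    (m_ge1 : (1 <= m)%N)
    (alpha_gt0 : forall j, (1 <= j <= m)%N -> 0 < alpha j)
    (S_symbol : forall z : R, z != 0 ->
       symbol S z = z ^ (- s) * (1 + z) *
         \prod_(1 <= j < m.+1) ((1 + alpha j * z) / (1 + alpha j)))
    (alpha1_min : forall j, (1 <= j <= m)%N ->
       Num.max (1 / (1 + alpha 1%N)) (alpha 1%N / (1 + alpha 1%N)) <=
       Num.max (1 / (1 + alpha j)) (alpha j / (1 + alpha j))) :
  forall p : int -> M, admissible Mt s m alpha p -> (delta p < +oo)%E ->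
    converges_from Mt s m alpha p.
Proof.
move=> p p_adm deltap.
have edge_delta i : ((mdist (p i) (p (i + 1)))%:E <= delta p)%E.
  by apply: ereal_sup_ubound; exists i.
have pD : edges_le p (fine (delta p)).
  move=> i; rewrite -lee_fin fineK// fin_real// deltap andbT.
  (* Any single edge keeps the supremum above [-oo]. *)
  by apply: lt_le_trans (edge_delta 0); rewrite ltNyr.
have mu01 := contraction_itv alpha_gt0 m_ge1.
apply: (geometric_uniform_cvg M_complete mu01) => k x.
exact: interpolant_step.
Qed.
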